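(* Let $1<q<\infty$. The minimal constant $c_{1,\infty}(q)>0$ for which $$\sup_{n\in\mathbb{N}}\,n\left(\frac{1}{n}\sum_{k=n}^\infty a_k^q\right)^{\frac{1}{q}}\leq c_{1,\infty}(q)\sup_{n\in\mathbb{N}} na_n$$ holds for all real sequences $(a_n)_{n\in\mathbb{N}}$ with $a_1\geq a_2\geq\ldots\geq 0$ is $c_{1,\infty}(q)=\zeta(q)^{\frac{1}{q}}$.
   Context: $\mathbb{N}=\{1,2,3,\ldots\}$. Suprema and sums of nonnegative terms take values in $[0,\infty]$. $\zeta(q)=\sum_{n=1}^\infty n^{-q}$ denotes the Riemann zeta function. *)

(* Defs.v *)
From HB Require Import structures.
From mathcomp Require Import all_boot all_order all_algebra.
From mathcomp Require Import all_classical all_reals all_analysis.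
Import Order.TTheory GRing.Theory Num.Theory.
Import numFieldNormedType.Exports.

Set Implicit Arguments.
Unset Strict Implicit.
Unset Printing Implicit Defensive.

Local Open Scope classical_set_scope.
Local Open Scope ring_scope.

Definition zeta (R : realType) (q : R) : R :=
  limn (fun N : nat => \sum_(1 <= n < N.+1) n%:R `^ (- q)).

(* Sequences are indexed by the positive integers: the junk value [a 0] is
   left unconstrained here and is never used below. *)
Definition nonneg_nonincreasing (R : realType) (a : nat -> R) : Prop :=
  forall n : nat, (1 <= n)%N -> 0 <= a n /\ a n.+1 <= a n.

Definition tail_mean_sup (R : realType) (q : R) (a : nat -> R) : \bar R :=
  ereal_sup [set (n%:R%:E * ((n%:R^-1)%:E *
      \sum_(n <= k <oo) (a k `^ q)%:E) `^ q^-1)%E | n in [set n | (1 <= n)%N]].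

Definition weak_sup (R : realType) (a : nat -> R) : \bar R :=
  ereal_sup [set (n%:R * a n)%:E | n in [set n | (1 <= n)%N]].

Definition admissible_constants (R : realType) (q : R) : set R :=
  [set c | 0 < c /\ forall a : nat -> R, nonneg_nonincreasing a ->
     (tail_mean_sup q a <= c%:E * weak_sup a)%E].

Definition is_least (R : realType) (A : set R) (c : R) : Prop :=
  A c /\ lbound A c.

(* Main.v *)
Require Import Defs.
From mathcomp Require Import all_boot all_order all_algebra.
From mathcomp Require Import all_classical all_reals all_analysis.
Import Order.TTheory GRing.Theory Num.Theory.
Import numFieldNormedType.Exports.

(** If [M] is the weak supremum of [a], then [a k <= M / k], so that bounding
the tail means of [a] reduces to the inequality
  n^(q-1) * (sum over k >= n of k^-q) <= zeta(q)   for every n >= 1,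
which says that the harmonic sequence has its largest tail mean at [n = 1].
To see it, cut the tail [k >= n] into the blocks [nj <= k < n(j+1)], [j >= 1].
Each block has [n] terms, all at most the first one, (nj)^-q; hence the tail is
at most n * n^-q * zeta(q). This is [sum_dilate_le] and its instance
[zeta_block_le].

The same block inequality for n = 2 gives the convergence of the zeta series:
with S the partial sums, S_(2N+1) <= 1 + 2^(1-q) S_N, which bounds S because
2^(1-q) < 1.

The constant is attained by the harmonic sequence [a k = 1 / k], whose weak
supremum is 1 and whose tail mean at [n = 1] is exactly zeta(q)^(1/q). *)

Set Implicit Arguments.
Unset Strict Implicit.
Unset Printing Implicit Defensive.

Local Open Scope classical_set_scope.
Local Open Scope ring_scope.

Lemma powR_invl (R : realType) (x p : R) : 0 <= x -> x^-1 `^ p = x `^ (- p).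
Proof. by move=> x0; rewrite -powR_inv1// -powRrM mulN1r. Qed.

(** On the block [nj <= k < n(j+1)], each of the [n] values of [f] is at most the
first one, [f (n * j)]. *)
Lemma sum_dilate_le (R : realType) (f : nat -> R) (n N : nat) :
  (forall i j : nat, (0 < i)%N -> (i <= j)%N -> f j <= f i) -> (0 < n)%N ->
  \sum_(n <= k < n * N.+1) f k <= n%:R * \sum_(1 <= j < N.+1) f (n * j)%N.
Proof.
move=> fdec n0; elim: N => [|N IH]; first by rewrite muln1 !big_geq// mulr0.
have nN : (n <= n * N.+1)%N by rewrite leq_pmulr.
have nNS : (n * N.+1 <= n * N.+2)%N by rewrite leq_mul2l leqnSn orbT.
rewrite (big_cat_nat nN nNS)/= (big_nat_recr N.+1)//= mulrDr lerD//.
have -> : n%:R * f (n * N.+1)%N =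
    \sum_(n * N.+1 <= k < n * N.+2) f (n * N.+1)%N.
  by rewrite sumr_const_nat -mulnBr subSnn muln1 mulr_natl.
apply: ler_sum_nat => k /andP[Nk _]; apply: fdec => //.
by rewrite muln_gt0 n0.
Qed.

Definition zeta_sum (R : realType) (q : R) (N : nat) : R :=
  \sum_(1 <= n < N.+1) n%:R `^ (- q).

Section zeta.
Context (R : realType) (q : R) (hq : 1 < q).

Let q0 : 0 < q. Proof. exact: lt_trans hq. Qed.

Lemma powRN_nonincreasing (i j : nat) :
  (0 < i)%N -> (i <= j)%N -> (j%:R : R) `^ (- q) <= i%:R `^ (- q).
Proof.
move=> i0 ij; have j0 := leq_trans i0 ij.
rewrite !powRN lef_pV2 ?posrE ?powR_gt0 ?ltr0n//.
by rewrite ge0_ler_powR ?nnegrE ?ler_nat// ltW.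
Qed.

Lemma zeta_block_le (n N : nat) : (0 < n)%N ->
  \sum_(n <= k < n * N.+1) (k%:R : R) `^ (- q) <=
  n%:R `^ (1 - q) * zeta_sum q N.
Proof.
move=> n0; apply: (le_trans (sum_dilate_le _ powRN_nonincreasing n0)).
rewrite powRD; last by rewrite pnatr_eq0 -lt0n n0 implybT.
rewrite powRr1// -mulrA ler_wpM2l// /zeta_sum mulr_sumr.
by apply: ler_sum => j _; rewrite natrM powRM.
Qed.

Lemma zeta_sum_nondecreasing :
  {homo @zeta_sum R q : m n / (m <= n)%N >-> m <= n}.
Proof.
apply/nondecreasing_seqP => n.
by rewrite /zeta_sum (big_nat_recr n.+1)//= lerDl powR_ge0.
Qed.

(** The block inequality with ratio 2 bounds the sum of the terms [2 <= k < 2N+2],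
so that S_N <= S_(2N+1) <= 1 + 2^(1-q) S_N; solving for S_N gives a bound that
does not depend on [N]. *)
Lemma zeta_sum_le (N : nat) : zeta_sum q N <= (1 - 2%:R `^ (1 - q))^-1.
Proof.
have r1 : (2%:R : R) `^ (1 - q) < 1.
  rewrite -opprB powRN invf_lt1 ?powR_gt0//.
  have := @gt0_ltr_powR R (q - 1) _ 1 2%:R; rewrite powR1 subr_gt0; apply=> //.
  - by rewrite nnegrE.
  - by rewrite nnegrE.
  - by rewrite ltr1n.
rewrite -[leRHS]mul1r ler_pdivlMr ?subr_gt0// mulrBr mulr1 lerBlDr.
(* Only the left-hand side is enlarged to S_(2N+1), whose terms from 2 on form
   complete blocks. *)
apply: le_trans (zeta_sum_nondecreasing (leq_addl N.+1 N)) _.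
rewrite {1}/zeta_sum big_ltn ?ltnS ?addSn// powR1 lerD2l [leRHS]mulrC.
have -> : (N + N).+2 = (2 * N.+1)%N by rewrite mul2n doubleS addnn.
exact: zeta_block_le.
Qed.

Lemma is_cvg_zeta_sum : cvgn (zeta_sum q).
Proof.
apply: nondecreasing_is_cvgn; first exact: zeta_sum_nondecreasing.
by exists (1 - 2%:R `^ (1 - q))^-1 => _ [N _ <-]; exact: zeta_sum_le.
Qed.

Lemma zeta_sum_le_zeta (N : nat) : zeta_sum q N <= zeta q.
Proof.
exact: nondecreasing_cvgn_le zeta_sum_nondecreasing is_cvg_zeta_sum N.
Qed.

Lemma zeta_ge1 : 1 <= zeta q.
Proof.
by apply: le_trans (zeta_sum_le_zeta 1); rewrite /zeta_sum big_nat1 powR1.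
Qed.

Lemma zeta_nneseries :
  (\sum_(1 <= k <oo) ((k%:R : R) `^ (- q))%:E = (zeta q)%:E)%E.
Proof.
rewrite -(EFin_lim is_cvg_zeta_sum); apply: cvg_lim => //.
rewrite -cvg_shiftS.
rewrite (_ : (fun n => _) = EFin \o zeta_sum q); last first.
  by apply/funext => n /=; rewrite /zeta_sum sumEFin.
rewrite EFin_lim; last exact: is_cvg_zeta_sum.
by apply: cvg_EFin; [exact: nearW|exact: is_cvg_zeta_sum].
Qed.

(** Among the sequences with [a k <= M / k], the tail is largest for [M / k]
itself, and there the block inequality applies. It is used on finite sums: any
[N] is below the end [n * N.+1] of the first [N] complete blocks. *)
Lemma nneseries_powR_tail_le (a : nat -> R) (M : R) (n : nat) :
  (forall k, (0 < k)%N -> 0 <= a k <= M / k%:R) -> (0 < n)%N ->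
  (\sum_(n <= k <oo) (a k `^ q)%:E <=
   (M `^ q * (n%:R `^ (1 - q) * zeta q))%:E)%E.
Proof.
move=> aM n0.
have M0 : 0 <= M.
  by have /andP[a1 /(le_trans a1)] := aM 1%N isT; rewrite divr1.
apply: lime_le.
  by apply: is_cvg_nneseries => k _ _; rewrite lee_fin powR_ge0.
apply: nearW => N; rewrite sumEFin lee_fin.
have aMq k : (n <= k < N)%N -> a k `^ q <= M `^ q * k%:R `^ (- q).
  move=> /andP[nk _]; have /andP[ak0 akM] := aM k (leq_trans n0 nk).
  apply: le_trans (ge0_ler_powR (ltW q0) _ _ akM) _; rewrite ?nnegrE//.
    by rewrite divr_ge0.
  by rewrite powRM ?invr_ge0// powR_invl.
apply: (le_trans (ler_sum_nat aMq)); rewrite -mulr_sumr ler_wpM2l ?powR_ge0//.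
apply: le_trans (_ : \sum_(n <= k < n * N.+1) (k%:R : R) `^ (- q) <= _).
  have [Nn|nN] := leqP N n.
    by rewrite big_geq// sumr_ge0// => k _; rewrite powR_ge0.
  have NnN : (N <= n * N.+1)%N by rewrite (leq_trans (leqnSn N))// leq_pmull.
  rewrite (big_cat_nat (ltnW nN) NnN)/= lerDl.
  by rewrite sumr_ge0// => k _; rewrite powR_ge0.
apply: le_trans (zeta_block_le _ n0) _.
by rewrite ler_wpM2l ?powR_ge0// zeta_sum_le_zeta.
Qed.

(** With the factor [n^-1] the tail bound becomes (M / n)^q zeta(q): the powers
of [n] are exactly those that the outer factor [n] cancels. *)
Lemma tail_mean_le (a : nat -> R) (M : R) (n : nat) :
  (forall k, (0 < k)%N -> 0 <= a k <= M / k%:R) -> (0 < n)%N ->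
  (n%:R%:E * ((n%:R^-1)%:E * \sum_(n <= k <oo) (a k `^ q)%:E) `^ q^-1 <=
   (zeta q `^ q^-1 * M)%:E)%E.
Proof.
move=> aM n0.
have M0 : 0 <= M.
  by have /andP[a1 /(le_trans a1)] := aM 1%N isT; rewrite divr1.
have nn0 : (0 : R) < n%:R by rewrite ltr0n.
have S0 : (0 <= (n%:R^-1)%:E * \sum_(n <= k <oo) (a k `^ q)%:E)%E.
  rewrite mule_ge0 ?lee_fin ?invr_ge0//.
  by apply: nneseries_ge0 => k _ _; rewrite lee_fin powR_ge0.
have Sle := nneseries_powR_tail_le aM n0.
have {}Sle : ((n%:R^-1)%:E * \sum_(n <= k <oo) (a k `^ q)%:E <=
    ((M / n%:R) `^ q * zeta q)%:E)%E.
  apply: le_trans (lee_wpmul2l _ Sle) _; first by rewrite lee_fin invr_ge0.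
  rewrite -EFinM lee_fin powRM ?invr_ge0//.
  rewrite powR_invl// powRD ?pnatr_eq0 ?(gtn_eqF n0) ?implybT// powRr1//.
  by rewrite mulrCA !mulrA divfK ?gt_eqF.
have z0 : 0 <= zeta q by exact: le_trans zeta_ge1.
have x0 : 0 <= M / n%:R by rewrite divr_ge0.
have qi : 0 <= q^-1 by rewrite invr_ge0 ltW.
apply: le_trans (lee_wpmul2l _ (gt0_ler_poweR qi _ _ Sle)) _.
- by rewrite lee_fin ltW.
- by rewrite in_itv/= S0 leey.
- by rewrite in_itv/= leey lee_fin mulr_ge0 ?powR_ge0.
rewrite poweR_EFin -EFinM lee_fin powRM ?powR_ge0// -powRrM mulfV ?gt_eqF//.
by rewrite powRr1// mulrA mulrCA divff ?gt_eqF// mulr1 mulrC.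
Qed.

End zeta.

Lemma weak_sup_bound (R : realType) (a : nat -> R) (M : R) :
  nonneg_nonincreasing a -> weak_sup a = M%:E ->
  forall k, (0 < k)%N -> 0 <= a k <= M / k%:R.
Proof.
move=> ha aM k k0; apply/andP; split; first by have [] := ha k k0.
rewrite ler_pdivlMr ?ltr0n// mulrC -lee_fin -aM.
by apply: ereal_sup_ubound; exists k.
Qed.

Lemma weak_sup_harmonic (R : realType) :
  weak_sup (fun k => (k%:R : R)^-1) = 1%:E.
Proof.
apply/eqP; rewrite eq_le; apply/andP; split.
  apply: ge_ereal_sup => _ [n n1 <-].
  by rewrite divff// pnatr_eq0 -lt0n.
by apply: ereal_sup_ubound; exists 1%N => //=; rewrite mul1r invr1.
Qed.

Theorem theorem3p2 (R : realType) (q : R) (hq : 1 < q) :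
  is_least (admissible_constants q) (zeta q `^ q^-1).
Proof.
have zgt0 : 0 < zeta q by exact: lt_le_trans (zeta_ge1 hq).
have cgt0 : 0 < zeta q `^ q^-1 by rewrite powR_gt0.
split.
- split=> // a ha; case aM : (weak_sup a) => [M| |].
  + apply: ge_ereal_sup => _ [n n1 <-]; rewrite -EFinM.
    by apply: tail_mean_le => // k k0; exact: weak_sup_bound aM k k0.
  + by rewrite gt0_muley ?lte_fin// leey.
  + (* The supremum is at least its term at 1, which is finite. *)
    have : ((1%:R * a 1%N)%:E <= weak_sup a)%E.
      by apply: ereal_sup_ubound; exists 1%N.
    by rewrite aM leeNy_eq.
- move=> c [_ /(_ (fun k => k%:R^-1))].
  rewrite weak_sup_harmonic mule1 -lee_fin => tc.
  apply: (le_trans _ (tc _)); last first.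
    move=> n n1; split; first by rewrite invr_ge0.
    by rewrite lef_pV2 ?posrE ?ltr0n// ler_nat.
  apply: ereal_sup_ubound; exists 1%N => //=.
  rewrite invr1 !mul1e -poweR_EFin -(zeta_nneseries hq).
  congr (limn _ `^ _)%E; apply/funext => N; apply: eq_bigr => k _.
  by rewrite powR_invl.
Qed.
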